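(* Let $0<c<1$, let $\alpha>\alpha'>\max(3/2,1/c)$ be fixed reals (depending on $c$), and let $\delta_0>\sqrt2$ be fixed. There exist two constants $C$ and $n_0$ depending on $c$ such that for any $n\ge n_0$ and $m\ge 2n$, $$\sup_{\substack{d<\frac{\pi}{\sqrt{2\alpha}}\sqrt{n/\log n}\\ \delta<\frac{\pi}{\delta_0\sqrt{2\alpha}}\sqrt{m/\log m}}}\big|\mathbf\Delta\big((d,n),(\delta,m)\big)\big|\le C\,n\Big(\frac{\log n}{n}\Big)^{\frac1{2c}}\Big(\frac{\log(m-n)}{m-n}\Big)^{1/2},$$ the supremum being over positive integers $d,\delta$.
   Context: $(\beta_i)_{i\ge1}$ is a sequence of independent Bernoulli random variables with $\mathbf P\{\beta_i=0\}=\mathbf P\{\beta_i=1\}=1/2$, and $B_n=\beta_1+\dots+\beta_n$. For positive integers $d,\delta$ and $n\le m$, $$\mathbf\Delta\big((d,n),(\delta,m)\big)=\mathbf P\{d\mid B_n,\ \delta\mid B_m\}-\mathbf P\{d\mid B_n\}\,\mathbf P\{\delta\mid B_m\}.$$ *)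

(* Defs.v *)
From HB Require Import structures.
From mathcomp Require Export all_boot all_order all_algebra.
From mathcomp Require Export all_classical all_reals all_analysis.

Set Implicit Arguments.
Unset Strict Implicit.
Unset Printing Implicit Defensive.

Import Order.TTheory GRing.Theory Num.Theory.
Import numFieldNormedType.Exports.

Local Open Scope classical_set_scope.
Local Open Scope ring_scope.

Definition mutually_independent (disp disp' : measure_display)
    (T : measurableType disp) (T' : measurableType disp') (R : realType)
    (P : probability T R) (X : nat -> {RV P >-> T'}) : Prop :=
  forall (s : seq nat) (A : nat -> set T'),
    uniq s -> (forall i, measurable (A i)) ->
    P (\bigcap_(i in [set` s]) (X i @^-1` A i)) =
    (\prod_(i <- s) P (X i @^-1` A i))%E.

Definition fair_bernoulli (disp : measure_display) (T : measurableType disp)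
    (R : realType) (P : probability T R) (X : {RV P >-> nat}) : Prop :=
  P (X @^-1` [set 0%N]) = (1 / 2)%:E /\ P (X @^-1` [set 1%N]) = (1 / 2)%:E.

Section BernoulliWalk.
Context (disp : measure_display) (T : measurableType disp) (R : realType)
  (P : probability T R) (beta : nat -> {RV P >-> nat}).

(* The sequence is indexed from 0: [beta i] is the variable written
   $\beta_{i+1}$ on paper, so [walk n] is $\beta_1 + \dots + \beta_n$. *)
Definition walk (n : nat) (w : T) : nat := (\sum_(i < n) beta i w)%N.

Definition div_event (u : nat * nat) : set T := [set w | (u.1 %| walk u.2 w)%N].

Definition Delta (u v : nat * nat) : R :=
  fine (P (div_event u `&` div_event v)) -
  fine (P (div_event u)) * fine (P (div_event v)).

End BernoulliWalk.

(* Main.v *)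
Require Import Defs.
From mathcomp Require Import all_boot all_order all_algebra.
From mathcomp Require Import all_classical all_reals all_analysis.
From mathcomp Require Import ring lra zify.
Import Order.TTheory GRing.Theory Num.Theory.
Import numFieldNormedType.Exports.
Local Open Scope classical_set_scope.
Local Open Scope ring_scope.

(** Given the first n steps, divisibility of B_m by delta depends only on the
m - n remaining ones. Expanding the indicator of the multiples of delta in the
functions k |-> cos (2 pi h k / delta), each step multiplies the h-th mode by
cos (pi h / delta), up to a phase shift. So, conditionally on any past,
the probability that delta divides B_m differs from 1 / delta by at most
q ^ (m - n), where q bounds |cos (pi h / delta)| for 0 < h < delta; hence
|Delta| <= 2 q ^ (m - n). The elementary choice q = exp (- (pi / delta)^2 / 4)
already gives |Delta| <= 2 m ^ (- alpha / 2) in the prescribed range of delta,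
which is below the claimed bound with C = 2 because alpha > max (1, 1 / c). *)

(** * Cosine bounds and cosine sums *)

(** By the mean value theorem [sin (x / 2)] equals [x / 2] times [cos y] for some [y <= pi / 4],
    where [cos y ^+ 2 >= 1 / 2]; the half-angle formula for [cos x] concludes. *)
Lemma cos_le_quadratic (R : realType) (x : R) :
  0 <= x -> x <= pi / 2 -> cos x <= 1 - x ^+ 2 / 4.
Proof.
move=> x0 xpi.
have [y /[!in_itv]/= /andP[y0 yx]] : exists2 y, y \in `[0, x / 2] &
    sin (x / 2) - sin 0 = cos y * (x / 2 - 0).
  apply: (@MVT_segment _ sin cos 0); first by lra.
  by apply: continuous_subspaceT => z; exact: continuous_sin.
rewrite sin0 !subr0 => sinE.
have cos2y : 0 <= cos (y *+ 2) by apply: cos_ge0_pihalf; lra.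
have cosy : 2^-1 <= cos y ^+ 2.
  move: cos2y; rewrite cos_mulr2n; lra.
have -> : cos x = 1 - sin (x / 2) ^+ 2 *+ 2.
  have {1}-> : x = (x / 2) *+ 2 by lra.
  by rewrite cos_mulr2n cos2sin2; ring.
rewrite sinE exprMn; have := sqr_ge0 (x / 2); nra.
Qed.

(** Replacing [h] by [delta - h] only flips the sign of the cosine, so the angle may be taken in
    [[0, pi / 2]]. There it is at least [pi / delta], and the quadratic bound is followed by
    [1 - u <= expR (- u)]. *)
Lemma norm_cos_div_le (R : realType) (delta h : nat) : (0 < h < delta)%N ->
  `|cos (h%:R * (pi / delta%:R)) : R| <= expR (- ((pi / delta%:R) ^+ 2 / 4)).
Proof.
have half (k : nat) : (0 < k)%N -> (k.*2 <= delta)%N ->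
    `|cos (k%:R * (pi / delta%:R)) : R| <= expR (- ((pi / delta%:R) ^+ 2 / 4)).
  move=> k0 kd; set t : R := pi / delta%:R.
  have d0 : (0 : R) < delta%:R by rewrite ltr0n; lia.
  have t0 : 0 < t by rewrite divr_gt0// pi_gt0.
  have kt : k%:R * t <= pi / 2.
    rewrite /t mulrA ler_pdivrMr//.
    have : k.*2%:R <= delta%:R :> R by rewrite ler_nat.
    rewrite -muln2 natrM; have := pi_gt0 R; nra.
  have k1 : (1 : R) <= k%:R by rewrite ler1n.
  have kt0 : 0 <= k%:R * t by nra.
  rewrite ger0_norm; last by apply: cos_ge0_pihalf; have := pi_gt0 R; lra.
  apply: (le_trans _ (expR_ge1Dx _)).
  apply: le_trans (@cos_le_quadratic _ _ kt0 kt) _.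
  have : t <= k%:R * t by nra.
  by rewrite lerD2l lerN2 => ?; rewrite ler_pM2r// ler_sqr ?nnegrE// ltW.
move=> /andP[h0 hd].
have [?|?] := leqP h.*2 delta; first exact: half.
have -> : cos (h%:R * (pi / delta%:R)) =
    - cos ((delta - h)%:R * (pi / delta%:R)) :> R.
  have d0 : (delta%:R : R) != 0 by rewrite pnatr_eq0; lia.
  have -> : (delta - h)%:R * (pi / delta%:R) = pi - h%:R * (pi / delta%:R) :> R.
    by rewrite natrB 1?ltnW//; field.
  by rewrite cosB cospi sinpi; ring.
by rewrite normrN; apply: half; lia.
Qed.

(* Telescoping: 2 sin x cos (2hx) = sin ((2h+1)x) - sin ((2h-1)x). *)
Lemma sin_sum_cos (R : realType) (n : nat) (x : R) :
  2 * sin x * (\sum_(h < n) cos ((2 * h)%:R * x)) = sin ((2 * n)%:R * x - x) + sin x.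
Proof.
elim: n => [|n ih].
  by rewrite big_ord0 muln0 mul0r sub0r sinN mulr0 addNr.
rewrite big_ord_recr/= mulrDr ih.
have -> : (2 * n.+1)%:R * x - x = (2 * n)%:R * x + x by rewrite mulnS natrD; ring.
by rewrite sinB sinD; ring.
Qed.

(** Real form of the orthogonality of characters modulo [delta]: all angles are multiples of 2 pi
    when [delta] divides [k], and otherwise the telescoped sum vanishes. *)
Lemma sum_cos_multiples (R : realType) (delta k : nat) : (0 < delta)%N ->
  \sum_(h < delta) cos ((2 * k)%:R * (h%:R * (pi / delta%:R))) =
  delta%:R * (delta %| k)%N%:R :> R.
Proof.
move=> delta0.
have d0 : (delta%:R : R) != 0 by rewrite pnatr_eq0 -lt0n.
have [/dvdnP[q ->]|ndvd] := boolP (delta %| k)%N.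
  rewrite (eq_bigr (fun=> 1)); first by rewrite sumr_const card_ord mulr1.
  move=> h _; rewrite -[RHS](@cos0 R) -(periodicn (@cosD2pi R) (q * h) 0); congr cos.
  by rewrite add0r -[in RHS]mulr_natr -[in RHS](mulr_natr pi) !natrM; field.
rewrite mulr0; set x : R := k%:R * (pi / delta%:R).
rewrite (eq_bigr (fun h : 'I_delta => cos ((2 * h)%:R * x))); last first.
  by move=> h _; rewrite /x !natrM; congr cos; ring.
(* Reducing [k] modulo [delta] shifts [x] by a multiple of pi, which affects only the sign of the
   sine, and leaves an angle strictly between 0 and pi. *)
have sinx : sin x != 0.
  rewrite /x [in k%:R](divn_eq k delta) natrD natrM.
  set r := (k %% delta)%N; set q := (k %/ delta)%N.
  have -> : (q%:R * delta%:R + r%:R) * (pi / delta%:R) =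
      r%:R * (pi / delta%:R) + pi *+ q :> R by rewrite -mulr_natr; field.
  rewrite alternatingn; last exact: sinDpi.
  rewrite mulf_neq0 ?signr_eq0//; apply/lt0r_neq0/sin_gt0_pi.
  have r0 : (0 : R) < r%:R by rewrite ltr0n lt0n.
  have dd : (0 : R) < delta%:R by rewrite ltr0n.
  rewrite mulr_gt0 ?divr_gt0 ?pi_gt0//=.
  by rewrite mulrA ltr_pdivrMr// mulrC ltr_pM2l ?pi_gt0// ltr_nat ltn_mod.
have := sin_sum_cos R delta x.
(* As [2 * delta * x] is 2 pi [k], the two sines on the right cancel. *)
have -> : (2 * delta)%:R * x - x = - x + pi *+ 2 *+ k.
  by rewrite -[in RHS]mulr_natr -[in RHS](mulr_natr pi) /x natrM; field.
rewrite (periodicn (@sinD2pi R)) sinN addNr => /eqP.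
by rewrite !mulf_eq0 (negbTE sinx) orbF pnatr_eq0/= => /eqP.
Qed.

(** * Averaging over fair steps *)

(** Transition operator of the fair walk: its [N]-th iterate at [k] is the mean of [f] at [k] plus
    [N] fair steps. *)
Definition avg (R : realType) (f : nat -> R) (k : nat) : R := (f k + f k.+1) / 2.

(** The phase [2 * k + N] is twice the mean position after [N] steps. With this centring, [cos (a -
    t) + cos (a + t) = 2 cos a cos t] shows that each averaging multiplies the mode by [cos t]. *)
Lemma iter_avg_dvdE (R : realType) (delta N k : nat) : (0 < delta)%N ->
  iter N (@avg R) (fun j => (delta %| j)%N%:R) k =
  delta%:R^-1 * \sum_(h < delta) cos (h%:R * (pi / delta%:R)) ^+ N *
     cos ((2 * k + N)%:R * (h%:R * (pi / delta%:R))).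
Proof.
move=> delta0; elim: N k => [|N ih] k /=.
  rewrite (eq_bigr (fun h : 'I_delta => cos ((2 * k)%:R * (h%:R * (pi / delta%:R))))).
    by rewrite sum_cos_multiples// mulKf// pnatr_eq0 -lt0n.
  by move=> h _; rewrite expr0 mul1r addn0.
rewrite /avg !ih -mulrDr -mulrA -big_split/= big_distrl/=; congr (_ * _).
apply: eq_bigr => h _; set t : R := h%:R * _.
have -> : (2 * k + N)%:R * t = (2 * k + N.+1)%:R * t - t.
  by rewrite addnS -natr1; ring.
have -> : (2 * k.+1 + N)%:R * t = (2 * k + N.+1)%:R * t + t.
  by rewrite mulnS addnS -natr1 -addnA natrD; ring.
by rewrite cosB cosD exprS; field.
Qed.

(** The mode [h = 0] contributes exactly [1 / delta]; the [delta - 1] others are each at most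
    [q ^+ N], and the prefactor [1 / delta] absorbs their number. *)
Lemma iter_avg_dvd_dist (R : realType) (delta N k : nat) : (0 < delta)%N ->
  `|iter N (@avg R) (fun j => (delta %| j)%N%:R) k - delta%:R^-1| <=
  expR (- ((pi / delta%:R) ^+ 2 / 4)) ^+ N.
Proof.
case: delta => // d _; rewrite iter_avg_dvdE//.
set q := expR _; rewrite big_ord_recl/= !mul0r !mulr0 !cos0 expr1n mulr1.
rewrite mulrDr mulr1 addrC addKr normrM ger0_norm ?invr_ge0//.
rewrite ler_pdivrMl ?ltr0n//.
apply: le_trans (ler_norm_sum _ _ _) _.
apply: (@le_trans _ _ (\sum_(i < d) q ^+ N)).
  apply: ler_sum => i _; rewrite normrM normrX.
  apply: le_trans (ler_piMr _ _) _; [exact: exprn_ge0|exact: cos_max|].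
  apply: lerXn2r; rewrite ?nnegrE ?expR_ge0//.
  by apply: norm_cos_div_le; rewrite /bump/= add1n ltnS ltn_ord.
rewrite sumr_const card_ord -[leLHS]mulr_natl ler_wpM2r ?exprn_ge0 ?expR_ge0//.
by rewrite ler_nat.
Qed.

(** * Comparison of the decay with the claimed rate *)

(** Since [delta0 ^+ 2 > 2], the range of [delta] forces [(pi / delta) ^+ 2] to be at least
    [4 * alpha * ln m / m], while [m - n >= m / 2]. *)
Lemma decay_rate (R : realType) (alpha delta0 : R) (n m delta : nat) :
  0 < alpha -> Num.sqrt 2 < delta0 -> (1 < m)%N -> (2 * n <= m)%N ->
  (0 < delta)%N ->
  delta%:R < pi / (delta0 * Num.sqrt (2 * alpha)) * Num.sqrt (m%:R / ln m%:R) ->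
  expR (- ((pi / delta%:R) ^+ 2 / 4)) ^+ (m - n) <= expR (- (alpha / 2 * ln m%:R)).
Proof.
move=> a0 d2 m1 nm dgt dlt.
have L0 : 0 < ln (m%:R : R) by rewrite ln_gt0// ltr1n.
have m0 : (0 : R) < m%:R by rewrite ltr0n; lia.
have d0 : (0 : R) < delta%:R by rewrite ltr0n.
have dd : 2 < delta0 ^+ 2.
  have s0 : 0 <= Num.sqrt (2 : R) by exact: sqrtr_ge0.
  by rewrite -[ltLHS](@sqr_sqrtr R 2)// ltr_sqr ?nnegrE//; lra.
have dp : 0 < delta0 by apply: le_lt_trans d2; exact: sqrtr_ge0.
have key : delta%:R ^+ 2 * (delta0 ^+ 2 * (2 * alpha) * ln m%:R) < pi ^+ 2 * m%:R.
  have : delta%:R ^+ 2 <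
      (pi / (delta0 * Num.sqrt (2 * alpha)) * Num.sqrt (m%:R / ln m%:R)) ^+ 2.
    by rewrite ltr_sqr ?nnegrE// ltW// (lt_trans d0).
  rewrite !exprMn exprVn exprMn !sqr_sqrtr; [|by rewrite divr_ge0 ?ltW|by lra].
  rewrite mulrACA -invfM ltr_pdivlMr//.
  by rewrite !mulr_gt0 ?exprn_gt0.
rewrite -expRM_natl ler_expR mulrN lerN2.
have : 2 * alpha * ln m%:R * 2 / m%:R <= (pi / delta%:R) ^+ 2.
  rewrite exprMn exprVn ler_pdivrMr// [leRHS]mulrAC ler_pdivlMr ?exprn_gt0//.
  apply/ltW/(le_lt_trans _ key).
  have : 0 <= delta%:R ^+ 2 * (2 * alpha * ln (m%:R : R)).
    by rewrite !mulr_ge0 ?exprn_ge0 ?ltW.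
  nra.
set u := (pi / _) ^+ 2 => hu.
have hN : (m%:R : R) / 2 <= (m - n)%:R.
  rewrite natrB; last by lia.
  have : ((2 * n)%:R : R) <= m%:R by rewrite ler_nat.
  rewrite natrM; lra.
(* The target exponent is exactly the product of the lower bounds for [m - n] and for [u / 4]. *)
apply: (@le_trans _ _ (m%:R / 2 * (2 * alpha * ln m%:R * 2 / m%:R / 4))).
  by rewrite le_eqVlt; apply/orP; left; apply/eqP; field; rewrite lt0r_neq0.
apply: ler_pM; rewrite ?divr_ge0 ?mulr_ge0 ?(ltW L0) ?(ltW m0) ?(ltW a0)//.
lra.
Qed.

Lemma rate_le (R : realType) (alpha c : R) (n m : nat) :
  1 <= alpha -> 0 < c -> 1 / c < alpha ->
  1 <= ln (n%:R : R) -> (2 * n <= m)%N ->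
  expR (- (alpha / 2 * ln m%:R)) <=
  n%:R * (ln n%:R / n%:R) `^ (1 / (2 * c)) *
    (ln (m%:R - n%:R) / (m%:R - n%:R)) `^ (1 / 2).
Proof.
move=> a1 c0 ca ln1n nm.
have n1 : (1 < n)%N.
  rewrite ltnNge; apply/negP => ?.
  have : ln (n%:R : R) <= 0 by rewrite ln_le0// lern1.
  lra.
have -> : (m%:R - n%:R : R) = (m - n)%:R by rewrite natrB//; lia.
set M := (m - n)%N.
have pn (k : nat) : (1 < k)%N -> (0 : R) < k%:R by move=> ?; rewrite ltr0n; lia.
have mono (j k : nat) : (1 < j)%N -> (j <= k)%N -> ln (j%:R : R) <= ln k%:R.
  by move=> j1 jk; rewrite ler_ln ?posrE ?ler_nat// pn//; lia.
have low (k : nat) (b : R) : (1 < k)%N -> 1 <= ln (k%:R : R) -> 0 <= b ->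
    expR (- (b * ln k%:R)) <= (ln k%:R / k%:R) `^ b.
  move=> k1 lk b0; have k0 := pn _ k1.
  have -> : expR (- (b * ln k%:R)) = (k%:R^-1) `^ b.
    by rewrite /powR invr_eq0 (gt_eqF k0) lnV ?posrE// mulrN.
  apply: ge0_ler_powR; rewrite ?nnegrE ?divr_ge0 ?invr_ge0 ?(ltW k0)//; first lra.
  by rewrite ler_pdivlMr// mulVf ?lt0r_neq0.
have nM : (n <= M)%N by rewrite /M; lia.
have lM := mono _ _ n1 nM.
have Mm : (M <= m)%N by rewrite /M; lia.
have lMm := mono _ _ (leq_trans n1 nM) Mm.
have a0 : 0 <= 1 / (2 * c) by rewrite divr_ge0//; lra.
have cE : 1 / (2 * c) = 1 / c / 2 by field; rewrite lt0r_neq0.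
apply: (@le_trans _ _ (n%:R * expR (- (1 / (2 * c) * ln n%:R)) *
    expR (- (1 / 2 * ln M%:R)))); last first.
  apply: ler_pM; rewrite ?mulr_ge0 ?expR_ge0//.
    by rewrite ler_pM2l ?pn// low.
  by apply: low; [lia|lra|lra].
rewrite -{1}(@lnK _ n%:R) ?posrE ?pn// -!expRD ler_expR cE.
set l := ln n%:R in ln1n lM lMm *; set b := 1 / c in ca *.
(* Bounding [ln M] by [ln m] leaves [l * (1 - b / 2) + (alpha - 1) / 2 * ln m >= 0]; as
   [alpha >= 1], replacing [ln m] by [l] gives [l * (1 + alpha - b) / 2], which is nonnegative. *)
have : 0 <= ln (m%:R : R) - l by lra.
nra.
Qed.

(** * Conditioning the walk on its first steps *)

Section FairWalk.
Context (R : realType) (disp : measure_display) (T : measurableType disp).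
Context (P : probability T R) (beta : nat -> {RV P >-> nat}).
Context (beta_bernoulli : forall i, fair_bernoulli (beta i)).
Context (beta_indep : mutually_independent beta).

(** Written as an intersection over a duplicate-free list of indices, the form to which
    [mutually_independent] applies. *)
Definition cylinder (s : seq bool) : set T :=
  \bigcap_(i in [set` iota 0 (size s)]) (beta i @^-1` [set nth false s i : nat]).

Lemma measurable_preim (i : nat) (A : set nat) : measurable (beta i @^-1` A).
Proof. by rewrite -[_ @^-1` _]setTI; exact: measurable_funP. Qed.

Lemma measurable_cylinder (s : seq bool) : measurable (cylinder s).
Proof.
by apply: fin_bigcap_measurable => // i _; exact: measurable_preim.
Qed.

Lemma measurable_walk (n : nat) (Q : set nat) : measurable (walk beta n @^-1` Q).
Proof.
have : measurable_fun setT (walk beta n).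
  elim: n => [|n ih].
    rewrite (_ : walk beta 0 = cst 0%N); first exact: measurable_cst.
    by apply/funext => w; rewrite /walk big_ord0.
  rewrite (_ : walk beta n.+1 = fun w => (walk beta n w + beta n w)%N).
    by apply: measurable_realfun.measurable_fun_addn => //; exact: measurable_funP.
  by apply/funext => w; rewrite /walk big_ord_recr.
by move=> /(_ measurableT Q I); rewrite setTI.
Qed.

Lemma probability_cylinder (s : seq bool) :
  P (cylinder s) = ((1 / 2) ^+ size s)%:E.
Proof.
rewrite /cylinder beta_indep ?iota_uniq//.
rewrite (eq_bigr (fun=> (1 / 2)%:E)); last first.
  by move=> i _; have [b0 b1] := beta_bernoulli i; case: (nth false s i).
by rewrite prodEFin big_const_seq count_predT size_iota -Monoid.iteropE.
Qed.

Lemma cylinder_rcons (s : seq bool) (b : bool) :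
  cylinder (rcons s b) = cylinder s `&` (beta (size s) @^-1` [set b : nat]).
Proof.
apply/seteqP; split=> [w ws|w [ws wb] i /=].
  split=> [i /=|/=].
    rewrite mem_iota/= => lti; have := ws i.
    by rewrite /= size_rcons mem_iota/= nth_rcons lti; apply; lia.
  by have := ws (size s); rewrite /= size_rcons mem_iota/= nth_rcons ltnn eqxx; apply; lia.
rewrite size_rcons mem_iota/= nth_rcons => ltis.
have [lti|gti|->//] := ltngtP i (size s); last by lia.
by have := ws i; rewrite /= mem_iota; apply.
Qed.

Lemma walk_cylinder (s : seq bool) (w : T) :
  cylinder s w -> walk beta (size s) w = count id s.
Proof.
move=> ws; rewrite -sum1_count big_mkcond (big_nth false) big_mkord.
apply: eq_bigr => i _; have -> : beta i w = nth false s i.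
  by have := ws i; rewrite /= mem_iota; apply; exact: ltn_ord.
by case: (nth false s i).
Qed.

(** The values 0 and 1 already carry total mass 1, so the part of the event where the next step
    takes another value is null. *)
Lemma probability_split (s : seq bool) (E : set T) : measurable E ->
  fine (P (cylinder s `&` E)) =
  fine (P (cylinder (rcons s false) `&` E)) + fine (P (cylinder (rcons s true) `&` E)).
Proof.
move=> mE; rewrite !cylinder_rcons /=.
set X0 := _ @^-1` [set 0%N]; set X1 := _ @^-1` [set 1%N].
set A := cylinder s `&` E.
have mA : measurable A by apply: measurableI => //; exact: measurable_cylinder.
have mX0 : measurable X0 by exact: measurable_preim.
have mX1 : measurable X1 by exact: measurable_preim.
have X01 : X0 `&` X1 = set0.
  by apply/seteqP; split=> // w; rewrite /X0 /X1 => -[/= ->].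
rewrite !(setIAC _ _ E) -/A -fineD ?fin_num_measure//; try exact: measurableI.
congr fine; rewrite -(measureU P); [|exact: measurableI|exact: measurableI|]; last first.
  by rewrite setIACA X01 setI0.
rewrite -setIUr (measureDI P mA (measurableU _ _ mX0 mX1)).
have [b0 b1] := beta_bernoulli (size s).
have PU : P (X0 `|` X1) = (1 / 2 + 1 / 2)%:E.
  by rewrite EFinD -{1}b0 -b1; exact: (measureU P).
have PX : P (~` (X0 `|` X1)) = 0%E.
  rewrite probability_setC ?PU; last exact: measurableU.
  by rewrite -EFinB; congr EFin; lra.
have PAX : P (A `\` (X0 `|` X1)) = 0%E.
  have mU : measurable (X0 `|` X1) by exact: measurableU.
  apply: (subset_measure0 (measurableD mA mU) (measurableC mU) _ PX).
  exact: subIsetr.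
by rewrite [X in (X + _)%E](_ : _ = 0%E) ?add0e.
Qed.

(** Revealing one more step splits the cylinder into two halves whose counts are [k] and [k.+1],
    which is one application of [avg]. The empty prefix gives the law of the walk itself. *)
Lemma probability_cylinder_walk (N : nat) (Q : pred nat) (s : seq bool) :
  fine (P (cylinder s `&` [set w | Q (walk beta (size s + N) w)])) =
  (1 / 2) ^+ size s * iter N (@avg R) (fun j => (Q j)%:R) (count id s).
Proof.
elim: N s => [|N ih] s.
  rewrite addn0 /=; have [Qs|nQs] := boolP (Q (count id s)).
    rewrite mulr1 (_ : _ `&` _ = cylinder s) ?probability_cylinder//.
    by apply/seteqP; split=> [w []//|w ws]; split=> //=; rewrite walk_cylinder.
  rewrite mulr0 (_ : _ `&` _ = set0) ?measure0//.
  by apply/seteqP; split=> // w [ws] /=; rewrite walk_cylinder// (negbTE nQs).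
rewrite probability_split; last exact: (measurable_walk _ [set k | Q k]).
have := ih (rcons s false); have := ih (rcons s true).
rewrite !size_rcons addSnnS => -> ->.
by rewrite -!cats1 !count_cat/= !addn0 addn1 /avg exprS; field.
Qed.

(* Downward induction on the length of the prefix [s]: once it is n, the event
   d | B_n is decided by [s], and otherwise one more step is revealed. *)
Lemma decorrelation (d delta n m k : nat) (eps : R) (s : seq bool) :
  (n <= m)%N -> (size s + k = n)%N ->
  (forall j, `|iter (m - n) (@avg R) (fun j => (delta %| j)%N%:R) j
               - delta%:R^-1| <= eps) ->
  `|fine (P (cylinder s `&` (div_event beta (d, n) `&` div_event beta (delta, m))))
    - delta%:R^-1 * fine (P (cylinder s `&` div_event beta (d, n)))|
  <= (1 / 2) ^+ size s * eps.
Proof.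
move=> nm sk heps; elim: k s sk => [|k ih] s sk.
  rewrite addn0 in sk; rewrite setIA; have [ds|nds] := boolP (d %| count id s)%N.
    have -> : cylinder s `&` div_event beta (d, n) = cylinder s.
      apply/seteqP; split=> [w []//|w ws]; split=> //.
      by rewrite /div_event/= -sk walk_cylinder.
    (* With the first [n] steps fixed, [m - n] remain, so [heps] applies at the current count. *)
    have -> : div_event beta (delta, m) =
        [set w | (dvdn delta) (walk beta (size s + (m - n)) w)].
      by rewrite sk subnKC.
    rewrite probability_cylinder_walk probability_cylinder/=.
    rewrite [X in _ - X]mulrC -mulrBr normrM ger0_norm ?exprn_ge0//.
    by rewrite ler_wpM2l ?exprn_ge0.
  have -> : cylinder s `&` div_event beta (d, n) = set0.
    apply/seteqP; split=> // w [ws].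
    by rewrite /div_event/= -sk walk_cylinder// (negbTE nds).
  rewrite set0I measure0 mulr0 subr0 normr0 mulr_ge0 ?exprn_ge0//.
  (* [eps] is nonnegative because it bounds an absolute value. *)
  by apply: le_trans (heps 0%N).
have mD (u : nat * nat) : measurable (div_event beta u).
  exact: (measurable_walk _ [set k | u.1 %| k]%N).
rewrite !(probability_split s)//; last exact: measurableI.
have := ih (rcons s false); have := ih (rcons s true).
rewrite !size_rcons addSnnS => /(_ sk) h1 /(_ sk) h0.
rewrite mulrDr opprD addrACA; apply: le_trans (ler_normD _ _) _.
apply: le_trans (lerD h0 h1) _; rewrite exprS; lra.
Qed.

(** Both the joint probability and the product are compared with [P D / delta]. The errors are at
    most [q ^+ (m - n)] and [q ^+ m], and [q <= 1]. *)
Lemma norm_Delta_le (d delta n m : nat) : (n <= m)%N -> (0 < delta)%N ->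
  `|Delta beta (d, n) (delta, m)| <=
  2 * expR (- ((pi / delta%:R) ^+ 2 / 4)) ^+ (m - n).
Proof.
move=> nm delta0; set q := expR _.
have q01 : 0 <= q <= 1.
  by rewrite expR_ge0 expR_le1 oppr_le0 divr_ge0// sqr_ge0.
have cyl0 : cylinder [::] = setT.
  by apply/seteqP; split=> // w _ i.
have := decorrelation d delta n m n (q ^+ (m - n)) [::] nm erefl
  (fun j => iter_avg_dvd_dist R delta (m - n) j delta0).
rewrite cyl0 !setTI expr0 mul1r.
have := iter_avg_dvd_dist R delta m 0 delta0.
have := probability_cylinder_walk m (dvdn delta) [::].
rewrite cyl0 setTI expr0 mul1r /= -/q => <-.
rewrite -[[set w | _]]/(div_event beta (delta, m)) /Delta.
set D := div_event beta (d, n); set G := div_event beta (delta, m) => hG hDG.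
have mD : measurable D by exact: (measurable_walk _ [set k | d %| k]%N).
have D01 : 0 <= fine (P D) <= 1.
  rewrite fine_ge0//= -lee_fin fineK ?fin_num_measure//; exact: probability_le1.
have qm : q ^+ m <= q ^+ (m - n) by case/andP: q01 => ? ?; apply: ler_wiXn2l => //; lia.
have -> : fine (P (D `&` G)) - fine (P D) * fine (P G) =
    (fine (P (D `&` G)) - delta%:R^-1 * fine (P D)) -
    fine (P D) * (fine (P G) - delta%:R^-1) by ring.
apply: le_trans (ler_normB _ _) _; rewrite mulr_natl mulr2n; apply: lerD => //.
rewrite normrM ger0_norm; last by case/andP: D01.
apply: le_trans (le_trans hG qm); rewrite ler_piMl//; by case/andP: D01.
Qed.

End FairWalk.

Theorem proposition2p9 (R : realType) (disp : measure_display)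
  (T : measurableType disp) (P : probability T R)
  (beta : nat -> {RV P >-> nat})
  (beta_bernoulli : forall i, fair_bernoulli (beta i))
  (beta_indep : mutually_independent beta)
  (c alpha alpha' delta0 : R)
  (c_gt0 : 0 < c) (c_lt1 : c < 1)
  (alpha'_gt : Num.max (3 / 2) (1 / c) < alpha')
  (alpha_gt : alpha' < alpha)
  (delta0_gt : Num.sqrt 2 < delta0) :
  exists (C : R) (n0 : nat), forall n m : nat,
    (n0 <= n)%N -> (2 * n <= m)%N ->
    (ereal_sup [set x : \bar R | exists d delta : nat,
        [/\ (0 < d)%N, (0 < delta)%N,
            (d%:R < pi / Num.sqrt (2 * alpha) * Num.sqrt (n%:R / ln n%:R))%R,
            (delta%:R < pi / (delta0 * Num.sqrt (2 * alpha))
                          * Num.sqrt (m%:R / ln m%:R))%R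
          & x = `|Delta beta (d, n) (delta, m)|%R%:E]]
     <= (C * n%:R * (ln n%:R / n%:R) `^ (1 / (2 * c))
           * (ln (m%:R - n%:R) / (m%:R - n%:R)) `^ (1 / 2))%R%:E)%E.
Proof.
move: alpha'_gt; rewrite gt_max => /andP[a'32 a'c].
(* The constant 2 is that of [norm_Delta_le]; the threshold makes [n] exceed e, so that [ln n >= 1]
   as [rate_le] requires. *)
exists 2, (Num.truncn (expR (1 : R))).+1 => n m n0n nm.
have n_gt : expR 1 < n%:R :> R.
  by apply: lt_le_trans (truncnS_gt _) _; rewrite ler_nat.
have n1 : (1 < n)%N by rewrite -(ltr_nat R); apply: lt_trans n_gt; rewrite expR_gt1.
have lnn : 1 <= ln (n%:R : R).
  have n0 : (0 : R) < n%:R by rewrite ltr0n ltnW.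
  by rewrite -[leLHS](@expRK R) ler_ln ?posrE ?expR_gt0// ltW.
apply: ge_ereal_sup => _ [d [delta [d0 delta_gt0 _ delta_lt ->]]].
rewrite lee_fin; have nm1 : (n <= m)%N by lia.
apply: (le_trans (norm_Delta_le _ _ _ _ _ beta_bernoulli beta_indep d _ _ _ nm1 delta_gt0)).
rewrite -[leRHS]mulrA -[leRHS]mulrA ler_pM2l// [leRHS]mulrA.
have m1 : (1 < m)%N by lia.
have alpha_gt0 : 0 < alpha by lra.
apply: (le_trans (decay_rate _ _ _ _ _ _ alpha_gt0 delta0_gt m1 nm delta_gt0 delta_lt)).
by apply: rate_le => //; lra.
Qed.
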